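(* Let $x\in\Omega_{\rm str}^\partial$ and let $A_x\phi=\Lambda\phi$ be a real eigenpair with $\|\phi\|_{L^2(M_x^\partial)}=1$ and $\Lambda>0$, where all objects are as defined in the context. Then $\phi^2$ belongs to $V_x$ and satisfies $$A_0(\phi^2)=2\Lambda\phi^2M_x^\partial-\Gamma_J(\phi)\,m\qquad\text{in }\mathcal D'(\mathbb T).$$ Both terms on the right are finite Radon measures, and $\Gamma_J(\phi)m\ll m$. Equivalently, for every real $\zeta\in C^\infty(\mathbb T)$, $$\mathcal E(\phi^2,\zeta)=2\Lambda\int_{\mathbb T}\zeta\phi^2\,dM_x^\partial-\int_{\mathbb T}\zeta\,\Gamma_J(\phi)\,dm.$$
   Context: $\mathbb T=\mathbb R/(2\pi\mathbb Z)$, $m(d\theta)=d\theta/(2\pi)$, $\widehat u(n)=\int u e^{-in\theta}dm$, $A_0e^{in\theta}=|n|e^{in\theta}$. The Cauchy form on real $H^{1/2}(\mathbb T)$ is $$\mathcal E(u,v)=\sum_{n\ne0}|n|\widehat u(n)\overline{\widehat v(n)}=\tfrac12\iint(u(\theta)-u(\varphi))(v(\theta)-v(\varphi))J(\theta,\varphi)\,m(d\theta)m(d\varphi),\quad J(\theta,\varphi)=\frac2{|e^{i\theta}-e^{i\varphi}|^2}.$$ For $u\in H^{1/2}(\mathbb T)$, $A_0u$ is the distribution $\langle A_0u,\zeta\rangle=\mathcal E(u,\zeta)$, $\zeta\in C^\infty(\mathbb T)$, and $\Gamma_J(u)(\theta)=\int_{\mathbb T}(u(\theta)-u(\varphi))^2J(\theta,\varphi)\,m(d\varphi)$,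 so that $\int\Gamma_J(u)\,dm=2\mathcal E(u,u)$. $\widetilde u$ is a quasi-continuous representative. Environment: $0<\gamma<2$, $\kappa=\gamma/2$; $X_{\rm C}=\dot H^{-s}(\mathbb T)$ (mean-zero distributions, fixed $s>0$) with $\mathbb P_{\rm C}$ the law of the centered Gaussian field $h$ with covariance $\sum_{n\ne0}|n|^{-1}e^{in(\theta-\varphi)}$, $h(x)=x$; Cameron--Martin space $H=\dot H^{1/2}(\mathbb T)$ (mean-zero). $P_\varepsilon=e^{-\varepsilon A_0}$, $M_{x,\varepsilon}^\partial(d\theta)=\exp(\kappa P_\varepsilon x(\theta)-\frac{\kappa^2}2\mathbb E_{\rm C}[(P_\varepsilon h(\theta))^2])m(d\theta)$. With $d_{\rm w}$ a complete metric for the narrow topology and $\varepsilon_j\downarrow0$ a fixed sequence with $\mathbb P_{\rm C}(d_{\rm w}(M_{h,\varepsilon_{j+1}}^\partial,M_{h,\varepsilon_j}^\partial)>2^{-j})\le2^{-j}$, $\Omega_{\rm GMC}^\partial$ is the full-probability Borel set of $x$ for which $(M_{x,\varepsilon_j}^\partial)$ is Cauchy and $M_x^\partial$ is the limit there ($0$ elsewhere). $\Omega_{\rm str}^\partial\subset\Omega_{\rm GMC}^\partial$ is a fixed Borel set of full probability such that for every $x$ in it: $M_x^\partial$ is finite, nonzero, has full support, is singular to $m$, satisfies $M_x^\partial(B(\theta,r))\le C_xr^{\alpha_x}$ for all $\theta$, $0<r\le1$, with some $C_x<\infty$, $\alpha_x>0$; it is a smooth measure (no charge on zero-capacity sets)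 of full quasi-support for the Cauchy form, and $\mathcal E$ on $V_x=\{u\in H^{1/2}(\mathbb T):\widetilde u\in L^2(M_x^\partial)\}$ is the (closed, densely defined, regular) time-changed form on $L^2(M_x^\partial)$; and the same holds for $e^{\kappa f}M_x^\partial$, $f\in C^\infty(\mathbb T)\cap H$. $A_x$ is the non-negative self-adjoint operator on $L^2(M_x^\partial)$ associated with $(\mathcal E,V_x)$. Positive-eigenvalue eigenfunctions are identified with their unique continuous representative. *)

(* Defs.v *)
From HB Require Import structures.
From mathcomp Require Import all_boot all_order all_algebra.
From mathcomp Require Import ring.
From mathcomp Require Import all_classical all_reals all_analysis.
Set Implicit Arguments.
Unset Strict Implicit.
Unset Printing Implicit Defensive.
Import Order.TTheory GRing.Theory Num.Theory.
Import numFieldNormedType.Exports.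
Local Open Scope classical_set_scope.
Local Open Scope ring_scope.

(* The circle T = R/2piZ.  Functions on T are 2pi-periodic functions on R,
   subsets of T are 2pi-periodic subsets of R (so that open, closed and Borel
   subsets of T are the periodic open, closed and Borel subsets of R), and Borel
   measures on T are Borel measures on R carried by [0, 2pi[, which makes
   \int[mu]_t f t the integral over T of a periodic f. *)

Definition fund (R : realType) : set R := `[0, pi *+ 2[.

Definition circle_fun (R : realType) (f : R -> R) : Prop := periodic f (pi *+ 2).

Definition circle_set (R : realType) (A : set R) : Prop :=
  forall t, A (t + pi *+ 2) <-> A t.

Definition arc (R : realType) (c r : R) : set R :=
  [set t | exists k : int, `|t - c + (pi *+ 2) *~ k| < r].

Lemma measurable_fund (R : realType) :
  measurable (@fund R : set (measurableTypeR R)).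
Proof. exact: measurable_itv. Qed.

Lemma inv2pi_ge0 (R : realType) : 0 <= (pi *+ 2 : R)^-1.
Proof. by rewrite invr_ge0 mulrn_wge0 ?pi_ge0. Qed.

Definition haar (R : realType) : set (measurableTypeR R) -> \bar R :=
  mscale (NngNum (inv2pi_ge0 R)) (mrestr lebesgue_measure (@measurable_fund R)).

HB.instance Definition _ (R : realType) := Measure.on (@haar R).

Lemma haar_setT (R : realType) : haar [set: measurableTypeR R] = 1%E.
Proof.
have p2 : 0 < pi *+ 2 :> R by rewrite mulrn_wgt0 ?pi_gt0.
transitivity (((pi *+ 2)^-1)%:E * lebesgue_measure (@fund R))%E.
  by congr (_ * lebesgue_measure _)%E; exact: setTI.
rewrite /fund lebesgue_measure_itv /= lte_fin p2.
by rewrite sube0 -EFinM mulVf ?gt_eqF.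
Qed.

HB.instance Definition _ (R : realType) :=
  Measure_isProbability.Build _ _ _ (@haar R) (@haar_setT R).

Record circle_measure (R : realType) := CircleMeasure {
  cmeasure :> {finite_measure set (measurableTypeR R) -> \bar R} ;
  cmeasure_fund : cmeasure (~` @fund R) = 0%E }.

HB.instance Definition _ (R : realType) := gen_eqMixin (circle_measure R).
HB.instance Definition _ (R : realType) := gen_choiceMixin (circle_measure R).

Section null_measure.
Context (R : realType).

Definition null_measure : set (measurableTypeR R) -> \bar R := mzero.

HB.instance Definition _ := Measure.on null_measure.

Lemma null_measure_fin : fin_num_fun null_measure.
Proof. by []. Qed.

HB.instance Definition _ :=
  Measure_isFinite.Build _ _ _ null_measure null_measure_fin.

End null_measure.

Definition circle_null (R : realType) : circle_measure R :=
  @CircleMeasure R (@null_measure R) erefl.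

(* Definite description, with value 0 if nothing satisfies Q. *)
Definition the_measure (R : realType) (Q : circle_measure R -> Prop) :
  circle_measure R := xget (circle_null R) [set mu | Q mu].

(* mu is the measure g nu. *)
Definition has_density (R : realType) (mu : circle_measure R)
    (nu : {measure set (measurableTypeR R) -> \bar R}) (g : R -> \bar R) : Prop :=
  forall A : set (measurableTypeR R), measurable A ->
    mu A = (\int[nu]_(t in A) g t)%E.

(* A Radon measure on T: inner regular with respect to the compact, that is the
   closed, subsets of T; finiteness is part of circle_measure. *)
Definition radon (R : realType) (mu : circle_measure R) : Prop :=
  forall A : set (measurableTypeR R), measurable A -> circle_set A ->
    mu A = ereal_sup
      [set mu K | K in [set K : set R | [/\ closed K, circle_set K & K `<=` A]]].

Definition L2 (R : realType)
    (mu : {measure set (measurableTypeR R) -> \bar R}) (f : R -> R) : Prop :=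
  [/\ measurable_fun [set: R] f, circle_fun f &
      (\int[mu]_t ((f t) ^+ 2)%:E < +oo)%E].

(* J(theta, phi) = 2 / |e^{i theta} - e^{i phi}|^2; it is 0 on the diagonal,
   where the increments it multiplies vanish. *)
Definition J (R : realType) (t p : R) : R :=
  2 / ((cos t - cos p) ^+ 2 + (sin t - sin p) ^+ 2).

Definition H12 (R : realType) (u : R -> R) : Prop :=
  L2 (@haar R) u /\
  (\int[(@haar R \x @haar R)%E]_z ((u z.1 - u z.2) ^+ 2 * J z.1 z.2)%:E < +oo)%E.

Definition cauchy_form (R : realType) (u v : R -> R) : R :=
  2^-1 * \int[(@haar R \x @haar R)%E]_z
           ((u z.1 - u z.2) * (v z.1 - v z.2) * J z.1 z.2).

Definition Gamma_J (R : realType) (u : R -> R) (t : R) : \bar R :=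
  (\int[@haar R]_p ((u t - u p) ^+ 2 * J t p)%:E)%E.

Definition cap_open (R : realType) (G : set R) : \bar R :=
  ereal_inf [set (cauchy_form u u + \int[@haar R]_t (u t) ^+ 2)%:E | u in
    [set u : R -> R | H12 u /\ {ae @haar R, forall t, G t -> 1 <= u t}]].

Definition cap (R : realType) (A : set R) : \bar R :=
  ereal_inf [set cap_open G | G in
    [set G : set R | [/\ open G, circle_set G & A `<=` G]]].

Definition quasi_continuous (R : realType) (v : R -> R) : Prop :=
  forall e : R, 0 < e -> exists G : set R,
    [/\ open G, circle_set G, (cap G < e%:E)%E & {within ~` G, continuous v}].

Definition quasi_closed (R : realType) (F : set R) : Prop :=
  forall e : R, 0 < e -> exists G : set R,
    [/\ open G, circle_set G, (cap G < e%:E)%E & closed (F `\` G)].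

Definition quasi_version (R : realType) (u v : R -> R) : Prop :=
  [/\ H12 v, quasi_continuous v & {ae @haar R, forall t, v t = u t}].

Definition V (R : realType) (M : circle_measure R) (u : R -> R) : Prop :=
  H12 u /\ exists v, quasi_version u v /\ L2 M v.

(* The quasi-continuous representatives, in L^2(M), of the elements of V. *)
Definition Vtilde (R : realType) (M : circle_measure R) (v : R -> R) : Prop :=
  [/\ H12 v, quasi_continuous v & L2 M v].

Definition form1 (R : realType) (M : circle_measure R) (v : R -> R) : R :=
  cauchy_form v v + \int[M]_t (v t) ^+ 2.

Definition form_closed (R : realType) (M : circle_measure R) : Prop :=
  forall v : nat -> R -> R, (forall n, Vtilde M (v n)) ->
    (forall e, 0 < e -> exists N, forall m n, (N <= m)%N -> (N <= n)%N ->
       form1 M (v m \- v n) < e) ->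
    exists2 w, Vtilde M w & form1 M (v n \- w) @[n --> \oo] --> (0 : R).

Definition form_dense (R : realType) (M : circle_measure R) : Prop :=
  forall f, L2 M f -> forall e : R, 0 < e ->
    exists2 v, Vtilde M v & \int[M]_t (f t - v t) ^+ 2 < e.

Definition form_regular (R : realType) (M : circle_measure R) : Prop :=
  (forall v, Vtilde M v -> forall e : R, 0 < e ->
     exists w : R -> R, [/\ continuous w, Vtilde M w & form1 M (v \- w) < e]) /\
  (forall f : R -> R, continuous f -> circle_fun f -> forall e : R, 0 < e ->
     exists w : R -> R,
       [/\ continuous w, Vtilde M w & forall t, `|f t - w t| < e]).

(* A phi = f, where A is the non-negative self-adjoint operator on L^2(M)
   associated with the closed form (cauchy_form, V M): phi, as an element of
   L^2(M), is in the form domain, and E(phi, w) = <f, w> for every w in it. *)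
Definition operator_graph (R : realType) (M : circle_measure R)
    (phi f : R -> R) : Prop :=
  [/\ L2 M phi, L2 M f & exists u v,
    [/\ H12 u, quasi_version u v, {ae M, forall t, v t = phi t} &
      forall w wt, H12 w -> quasi_version w wt -> L2 M wt ->
        cauchy_form u w = \int[M]_t (f t * wt t)]].

Record structural (R : realType) (M : circle_measure R) : Prop := {
  str_nonzero : M setT != 0%E ;
  str_full_support : forall U : set R, open U -> circle_set U -> U !=set0 ->
    (0 < M U)%E ;
  str_singular : exists N : set (measurableTypeR R),
    [/\ measurable N, haar N = 0%E & M (~` N) = 0%E] ;
  str_holder : exists C alpha : R, 0 < alpha /\
    forall t r, 0 < r <= 1 -> (M (arc t r) <= (C * r `^ alpha)%:E)%E ;
  str_smooth : forall N : set (measurableTypeR R), measurable N ->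
    circle_set N -> cap N = 0%E -> M N = 0%E ;
  str_full_quasi_support : forall F : set (measurableTypeR R), measurable F ->
    circle_set F -> quasi_closed F -> M (~` F) = 0%E -> cap (~` F) = 0%E ;
  str_closed : form_closed M ;
  str_dense : form_dense M ;
  str_regular : form_regular M }.

Record testfun (R : realType) := TestFun {
  tfun :> R -> R ;
  tfun_periodic : circle_fun tfun ;
  tfun_smooth : forall n t, derivable (derive1n n tfun) t 1 }.

(* D'(T), as a predicate on the functionals on C^infty(T). *)
Definition is_distribution (R : realType) (x : testfun R -> R) : Prop :=
  (forall (a : R) (z1 z2 z3 : testfun R), (forall t, z3 t = a * z1 t + z2 t) ->
     x z3 = a * x z1 + x z2) /\
  (exists (C : R) (k : nat), forall (z : testfun R) (B : R),
     (forall j t, (j <= k)%N -> `|derive1n j z t| <= B) -> `|x z| <= C * B).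

Definition A0 (R : realType) (u : R -> R) : testfun R -> R :=
  fun z => cauchy_form u z.

Definition measure_distr (R : realType) (mu : circle_measure R) :
  testfun R -> R := fun z => \int[mu]_t z t.

Lemma trig_derive1 (R : realType) (n : nat) (a b t : R) :
  is_derive t 1 (fun t : R => a * cos (n%:R * t) + b * sin (n%:R * t))
    (n%:R * b * cos (n%:R * t) + - (n%:R * a) * sin (n%:R * t)).
Proof.
have D : is_derive t 1 (fun t : R => n%:R * t) n%:R.
  apply: is_derive_eq; by rewrite /GRing.scale /= mulr1.
apply: is_derive_eq.
by rewrite /GRing.scale /=; ring.
Qed.

Lemma trig_smooth (R : realType) (n : nat) (a b : R) (k : nat) (t : R) :
  derivable
    (derive1n k (fun t : R => a * cos (n%:R * t) + b * sin (n%:R * t))) t 1.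
Proof.
have [a' [b' ->]] : exists a' b', derive1n k
    (fun t : R => a * cos (n%:R * t) + b * sin (n%:R * t)) =
    (fun t : R => a' * cos (n%:R * t) + b' * sin (n%:R * t)).
  elim: k => [|k [a' [b' IH]]]; first by exists a, b.
  exists (n%:R * b'), (- (n%:R * a')); rewrite derive1nS IH.
  by apply/funext => r; rewrite derive1E; have [_ ->] := trig_derive1 n a' b' r.
by have [] := trig_derive1 n a' b' t.
Qed.

Lemma trig_periodic (R : realType) (n : nat) (a b : R) :
  circle_fun (fun t : R => a * cos (n%:R * t) + b * sin (n%:R * t)).
Proof.
move=> t; rewrite mulrDr mulr_natl mulrnAC -mulr_natl.
rewrite -[_ *+ n in X in _ + X]mulr_natl.
by rewrite !mulr_natl (periodicn (@cosD2pi R)) (periodicn (@sinD2pi R)).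
Qed.

(* a cos(n t) + b sin(n t) *)
Definition trig_test (R : realType) (n : nat) (a b : R) : testfun R :=
  TestFun (@trig_periodic R n a b) (@trig_smooth R n a b).

(* For a real distribution, xhat(n) = x(cos n) - i x(sin n) and xhat(-n) is its
   conjugate, so a sum over n <> 0 of a conjugation invariant quantity is twice
   the sum over n >= 1. *)
Definition hat_sqnorm (R : realType) (x : testfun R -> R) (n : nat) : R :=
  x (trig_test n 1 0) ^+ 2 + x (trig_test n 0 1) ^+ 2.

Definition Hminus_sqnorm (R : realType) (s : R) (x : testfun R -> R) : \bar R :=
  (\sum_(1 <= n <oo) (2 * n%:R `^ (- (2 * s)) * hat_sqnorm x n)%:E)%E.

Record XC (R : realType) (s : R) := MkXC {
  xc_distr :> testfun R -> R ;
  xc_isd : is_distribution xc_distr ;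
  xc_mean0 : xc_distr (trig_test 0 1 0) = 0 ;
  xc_norm : (Hminus_sqnorm s xc_distr < +oo)%E }.

Lemma zero_is_distribution (R : realType) :
  is_distribution (fun _ : testfun R => 0).
Proof.
split=> [a z1 z2 z3 _|]; first by rewrite mulr0 addr0.
by exists 0, 0%N => z B _; rewrite mul0r normr0.
Qed.

Lemma zero_Hminus (R : realType) (s : R) :
  (Hminus_sqnorm s (fun _ : testfun R => 0%R) < +oo)%E.
Proof.
rewrite /Hminus_sqnorm eseries0 ?ltry// => n _ _.
by rewrite /hat_sqnorm expr0n /= addr0 mulr0.
Qed.

Definition XC0 (R : realType) (s : R) : XC s :=
  MkXC (@zero_is_distribution R) erefl (@zero_Hminus R s).

HB.instance Definition _ (R : realType) (s : R) := gen_eqMixin (XC s).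
HB.instance Definition _ (R : realType) (s : R) := gen_choiceMixin (XC s).
HB.instance Definition _ (R : realType) (s : R) := isPointed.Build (XC s) (XC0 s).

Definition XC_open (R : realType) (s : R) : set (set (XC s)) :=
  [set U | forall x : XC s, U x -> exists2 e : R, 0 < e &
    forall y : XC s, (Hminus_sqnorm s (fun z => x z - y z)%R < e%:E)%E -> U y].

(* Hdot^{-s}(T) with its Borel sigma-algebra. *)
Definition XCb (R : realType) (s : R) := g_sigma_algebraType (@XC_open R s).

Definition centered_gaussian (R : realType) (v : R) (A : set R) : \bar R :=
  if v == 0 then \d_(0 : R) A else normal_prob 0 (Num.sqrt v) A.

(* The variance sum_{n <> 0} |n|^{-1} |zhat(n)|^2 of the pairing with z. *)
Definition field_variance (R : realType) (z : testfun R) : R :=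
  fine (\sum_(1 <= n <oo)
    (2 / n%:R * hat_sqnorm (fun w => \int[@haar R]_t (z t * w t)) n)%:E)%E.

(* Joint Gaussianity and the covariances follow by linearity in z. *)
Definition is_field_law (R : realType) (s : R)
    (P : probability (XCb s) R) : Prop :=
  forall (z : testfun R) (A : set (measurableTypeR R)), measurable A ->
    P [set x : XC s | A (x z)] = centered_gaussian (field_variance z) A.

Definition P_reg (R : realType) (e : R) (x : testfun R -> R) (t : R) : R :=
  limn (fun N => \sum_(1 <= n < N) 2 * expR (- (e * n%:R)) *
    (x (trig_test n 1 0) * cos (n%:R * t) + x (trig_test n 0 1) * sin (n%:R * t))).

Definition gmc_reg (R : realType) (s kappa : R) (P : probability (XCb s) R)
    (e : R) (x : XC s) : circle_measure R :=
  the_measure (fun mu => has_density mu (@haar R) (fun t =>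
    (expR (kappa * P_reg e x t -
           kappa ^+ 2 / 2 * \int[P]_y (P_reg e (y : XC s) t) ^+ 2))%:E)).

Record narrow_metric (R : realType)
    (d : circle_measure R -> circle_measure R -> R) : Prop := {
  nm_eq0 : forall mu nu, d mu nu = 0 <->
    forall A : set (measurableTypeR R), measurable A -> mu A = nu A ;
  nm_sym : forall mu nu, d mu nu = d nu mu ;
  nm_triangle : forall mu nu rho, d mu rho <= d mu nu + d nu rho ;
  nm_complete : forall mu : nat -> circle_measure R,
    (forall e, 0 < e -> exists N, forall i j, (N <= i)%N -> (N <= j)%N ->
       d (mu i) (mu j) < e) ->
    exists nu, d (mu n) nu @[n --> \oo] --> (0 : R) ;
  nm_fine : forall mu (f : R -> R), continuous f -> circle_fun f ->
    forall e : R, 0 < e -> exists2 r : R, 0 < r & forall nu, d mu nu < r ->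
      `|\int[nu]_t f t - \int[mu]_t f t| < e ;
  nm_coarse : forall (mu : circle_measure R) (r : R), 0 < r ->
    exists (n : nat) (f : 'I_n -> R -> R) (e : R),
      [/\ 0 < e, forall i, continuous (f i) /\ circle_fun (f i) &
        forall nu : circle_measure R,
          (forall i, `|\int[nu]_t f i t - \int[mu]_t f i t| < e) ->
          d mu nu < r] }.

Definition admissible_scales (R : realType) (s kappa : R)
    (P : probability (XCb s) R)
    (dw : circle_measure R -> circle_measure R -> R) (eps : nat -> R) : Prop :=
  [/\ forall j, 0 < eps j, {homo eps : i j / (i <= j)%N >-> j <= i},
      eps j @[j --> \oo] --> (0 : R) &
      forall j, (P [set x : XC s |
          (2^-1 ^+ j < dw (gmc_reg kappa P (eps j.+1) x)
                          (gmc_reg kappa P (eps j) x))%R]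
        <= (2^-1 ^+ j)%:E)%E].

Definition Omega_GMC (R : realType) (s kappa : R) (P : probability (XCb s) R)
    (dw : circle_measure R -> circle_measure R -> R) (eps : nat -> R) :
    set (XC s) :=
  [set x | forall e, 0 < e -> exists N, forall i j, (N <= i)%N -> (N <= j)%N ->
     dw (gmc_reg kappa P (eps i) x) (gmc_reg kappa P (eps j) x) < e].

Definition gmc (R : realType) (s kappa : R) (P : probability (XCb s) R)
    (dw : circle_measure R -> circle_measure R -> R) (eps : nat -> R)
    (x : XC s) : circle_measure R :=
  the_measure (fun mu => Omega_GMC kappa P dw eps x /\
    dw (gmc_reg kappa P (eps j) x) mu @[j --> \oo] --> (0 : R)).

Definition tilt (R : realType) (kappa : R) (f : R -> R) (M : circle_measure R) :
  circle_measure R :=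
  the_measure (fun mu => has_density mu M (fun t => (expR (kappa * f t))%:E)).

Record is_Omega_str (R : realType) (s kappa : R) (P : probability (XCb s) R)
    (dw : circle_measure R -> circle_measure R -> R) (eps : nat -> R)
    (Ostr : set (XCb s)) : Prop := {
  Ostr_measurable : measurable Ostr ;
  Ostr_full : P Ostr = 1%E ;
  Ostr_sub : Ostr `<=` Omega_GMC kappa P dw eps ;
  Ostr_structural : forall x : XC s, Ostr x ->
    structural (gmc kappa P dw eps x) ;
  Ostr_tilt : forall x : XC s, Ostr x -> forall f : testfun R,
    \int[@haar R]_t f t = 0 -> structural (tilt kappa f (gmc kappa P dw eps x)) }.

(* Main.v *)
From HB Require Import structures.
Require Import Defs.
From mathcomp Require Import all_boot all_order all_algebra.
From mathcomp Require Import ring lra.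
From mathcomp Require Import all_classical all_reals all_analysis.
From mathcomp Require Import measurable_realfun.
Import Order.TTheory GRing.Theory Num.Theory.
Import numFieldNormedType.Exports.
Set Implicit Arguments.
Unset Strict Implicit.
Unset Printing Implicit Defensive.
Local Open Scope classical_set_scope.
Local Open Scope ring_scope.

(* The identity
     (a^2 - b^2)(c - d) = 2 (a - b)(a c - b d) - (c + d)(a - b)^2,
   with a, b values of phi and c, d values of zeta, integrates against J to
     E(phi^2, zeta) = 2 E(phi, phi zeta) - int zeta Gamma_J(phi) dm,
   and testing the eigenvalue equation with phi zeta turns the first term into
   2 Lambda int zeta phi^2 dM.  The eigenvalue equation involves a
   quasi-continuous function equal to phi only M-almost everywhere; the full
   quasi-support of M makes it equal to phi m-almost everywhere, which identifies
   it with phi in H^{1/2}. *)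

(** * Energy integrands on the circle, and products of bounded functions in H^{1/2} *)

Section circle_integrands.
Context {R : realType}.
Implicit Types u v w : R -> R.
Local Notation T := (measurableTypeR R).
Local Notation hh := (@haar R \x @haar R)%E.

Definition energy_density u v (z : R * R) : R :=
  (u z.1 - u z.2) * (v z.1 - v z.2) * J z.1 z.2.

Lemma J_ge0 (t p : R) : 0 <= J t p.
Proof. by rewrite divr_ge0// addr_ge0// sqr_ge0. Qed.

Lemma J_sym (t p : R) : J t p = J p t.
Proof. by rewrite /J -(opprB (cos t)) -(opprB (sin t)) !sqrrN. Qed.

Lemma measurable_comp_fst u : measurable_fun [set: R] u ->
  measurable_fun [set: T * T] (fun z => u z.1).
Proof. by move=> mu; apply: measurableT_comp => //; exact: measurable_fst. Qed.

Lemma measurable_comp_snd u : measurable_fun [set: R] u ->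
  measurable_fun [set: T * T] (fun z => u z.2).
Proof. by move=> mu; apply: measurableT_comp => //; exact: measurable_snd. Qed.

Lemma measurable_J : measurable_fun [set: T * T] (fun z => J z.1 z.2).
Proof.
have mc : measurable_fun [set: R] (@cos R).
  by apply: continuous_measurable_fun; exact: continuous_cos.
have ms : measurable_fun [set: R] (@sin R).
  by apply: continuous_measurable_fun; exact: continuous_sin.
(* The inverse becomes the real power with exponent -1, to which [measurable_powR] applies. Both
   vanish at 0, so the diagonal is no exception. *)
rewrite [X in measurable_fun _ X](_ : _ = fun z : T * T => 2 *
    ((cos z.1 - cos z.2) ^+ 2 + (sin z.1 - sin z.2) ^+ 2) `^ (-1)); last first.
  apply/funext => z; rewrite /J powR_inv1// addr_ge0// sqr_ge0//.
apply: measurable_funM => //.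
apply: (measurableT_comp (measurable_powR _)).
apply: measurable_funD; apply: measurable_funX; apply: measurable_funB;
  by [apply: measurable_comp_fst|apply: measurable_comp_snd].
Qed.

Lemma measurable_energy_density u v : measurable_fun [set: R] u ->
  measurable_fun [set: R] v ->
  measurable_fun [set: T * T] (energy_density u v).
Proof.
move=> mu mv; apply: measurable_funM; last exact: measurable_J.
by apply: measurable_funM; apply: measurable_funB;
  by [apply: measurable_comp_fst|apply: measurable_comp_snd].
Qed.

Lemma energy_density_ge0 u z : 0 <= energy_density u u z.
Proof. by rewrite mulr_ge0 ?J_ge0// -expr2 sqr_ge0. Qed.

Lemma H12_measurable u : H12 u -> measurable_fun [set: R] u.
Proof. by case=> -[]. Qed.

Lemma H12_zero : H12 (fun _ : R => 0 : R).
Proof.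
split; first split => //.
  by under eq_integral do rewrite expr0n/=; rewrite integral0 ltry.
by under eq_integral do rewrite subrr expr0n/= mul0r; rewrite integral0 ltry.
Qed.

Lemma integrable_energy_diag u : H12 u ->
  hh.-integrable setT (EFin \o energy_density u u).
Proof.
move=> hu; apply/integrableP; split.
  by apply/measurable_EFinP; apply: measurable_energy_density; exact: H12_measurable.
case: hu => _; congr (_ < _)%E; apply: eq_integral => z _ /=.
by rewrite ger0_norm ?energy_density_ge0// /energy_density -expr2.
Qed.

(** The bound |ab| <= a^2 + b^2 on the increments dominates the mixed density by the sum of the two
    diagonal ones. *)
Lemma integrable_energy u v : H12 u -> H12 v ->
  hh.-integrable setT (EFin \o energy_density u v).
Proof.
move=> hu hv.
apply: (@le_integrable _ _ _ _ _ measurableT _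
  (fun z : T * T => (energy_density u u z)%:E + (energy_density v v z)%:E)%E).
- by apply/measurable_EFinP; apply: measurable_energy_density; exact: H12_measurable.
- move=> z _; rewrite -EFinD !abse_EFin lee_fin /energy_density -mulrDl !normrM.
  apply: ler_wpM2r => //.
  set a := u z.1 - u z.2; set b := v z.1 - v z.2.
  have := sqr_ge0 (`|a| - `|b|); have := sqr_ge0 (`|a| + `|b|).
  have -> : `|a * a + b * b| = `|a| ^+ 2 + `|b| ^+ 2.
    by rewrite -!expr2 !real_normK ?num_real// ger0_norm// addr_ge0// sqr_ge0.
  nra.
- by apply: integrableD => //; exact: integrable_energy_diag.
Qed.

(** A criterion by domination: the sup bound gives square integrability because [haar] is a
    probability, and the pointwise bound gives finite energy. The summand 1 admits functions whose
    energy density is merely bounded, such as test functions. *)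
Lemma H12_le u (C : R) v w : measurable_fun [set: R] u -> circle_fun u ->
  (forall t, `|u t| <= C) -> H12 v -> H12 w ->
  (forall z, energy_density u u z <=
     C * (energy_density v v z + energy_density w w z + 1)) -> H12 u.
Proof.
move=> mu pu uC hv hw le; split.
  split=> //.
  apply: (@le_lt_trans _ _ (\int[@haar R]_t (C ^+ 2)%:E)%E).
    apply: ge0_le_integral => //.
    + by move=> t _; rewrite lee_fin sqr_ge0.
    + by apply/measurable_EFinP; apply: measurable_funX.
    + move=> t _; rewrite lee_fin -(real_normK (num_real (u t))).
      by rewrite lerXn2r ?nnegrE// (le_trans _ (uC t)).
  by rewrite integral_cst//= [X in (_ * X)%E](haar_setT R) mule1 ltry.
have : hh.-integrable setT (EFin \o energy_density u u).
  apply: (@le_integrable _ _ _ _ _ measurableT _ (fun z : T * T => C%:E *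
    ((energy_density v v z)%:E + (energy_density w w z)%:E + cst 1 z))%E).
  - by apply/measurable_EFinP; apply: measurable_energy_density.
  - move=> z _; rewrite /cst -!EFinD -EFinM !abse_EFin lee_fin.
    by rewrite !ger0_norm ?energy_density_ge0// (le_trans _ (le z))// energy_density_ge0.
  - apply: integrableZl => //; apply: integrableD => //.
      by apply: integrableD => //; exact: integrable_energy_diag.
    apply/integrableP; split => //.
    rewrite integral_cst//= normr1 mul1e.
    rewrite -[X in hh X]setXTT product_measure1E//.
    by rewrite [X in (X * _)%E](haar_setT R) [X in (_ * X)%E](haar_setT R) mule1 ltry.
move/integrableP => [_]; congr (_ < _)%E; apply: eq_integral => z _ /=.
by rewrite ger0_norm ?energy_density_ge0// /energy_density -expr2.
Qed.

(** The increment of a product is c(a - b) + b(c - d), so bounds on both factors turn their finite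
    energies into one for the product. *)
Lemma H12_mul u v (A B : R) : H12 u -> H12 v ->
  (forall t, `|u t| <= A) -> (forall t, `|v t| <= B) ->
  H12 (fun t => u t * v t).
Proof.
move=> hu hv uA vB.
have A0 : 0 <= A by rewrite (le_trans _ (uA 0)).
have B0 : 0 <= B by rewrite (le_trans _ (vB 0)).
(* The term [A * B] serves the sup bound of the product; the other two dominate its energy
   density. *)
apply: (@H12_le _ (A * B + 2 * A ^+ 2 + 2 * B ^+ 2) u v) => //.
- by apply: measurable_funM; exact: H12_measurable.
- by move=> t; case: hu hv => -[_ pu _] _ [[_ pv _] _]; rewrite pu pv.
- move=> t; rewrite normrM (le_trans (ler_pM _ _ (uA t) (vB t)))//.
  by rewrite -addrA lerDl addr_ge0// mulr_ge0// sqr_ge0.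
- move=> z; rewrite /energy_density.
  have := J_ge0 z.1 z.2; move: (J _ _) => j j0.
  have := uA z.1; have := uA z.2; have := vB z.1; have := vB z.2.
  rewrite !ler_norml.
  move: (u z.1) (u z.2) (v z.1) (v z.2) => a b c d /andP[d1 d2] /andP[c1 c2] /andP[b1 b2] /andP[a1 a2].
  have e : a * c - b * d = c * (a - b) + b * (c - d) by ring.
  have h : (a * c - b * d) * (a * c - b * d) <=
      2 * B ^+ 2 * ((a - b) * (a - b)) + 2 * A ^+ 2 * ((c - d) * (c - d)).
    have cB : c ^+ 2 <= B ^+ 2 by rewrite -ler_sqrt ?sqr_ge0// !sqrtr_sqr ler_norml ger0_norm//; apply/andP.
    have bA : b ^+ 2 <= A ^+ 2 by rewrite -ler_sqrt ?sqr_ge0// !sqrtr_sqr ler_norml ger0_norm//; apply/andP.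
    rewrite e.
    have := sqr_ge0 (c * (a - b) - b * (c - d)).
    have := ler_wpM2r (sqr_ge0 (a - b)) cB.
    have := ler_wpM2r (sqr_ge0 (c - d)) bA.
    nra.
  apply: (le_trans (ler_wpM2r j0 h)).
  have s1 := mulr_ge0 (sqr_ge0 (a - b)) j0.
  have s2 := mulr_ge0 (sqr_ge0 (c - d)) j0.
  have s3 := mulr_ge0 A0 B0; have s4 := sqr_ge0 A; have s5 := sqr_ge0 B.
  rewrite !expr2 in s1 s2 s4 s5 *.
  nra.
Qed.

Lemma ae_mono d (X : measurableType d) (mu : set X -> \bar R) (P Q : X -> Prop) :
  (forall t, P t -> Q t) -> {ae mu, forall t, P t} -> {ae mu, forall t, Q t}.
Proof.
by move=> PQ [N [mN N0 PN]]; exists N; split => // t nQ; apply: PN => /PQ.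
Qed.

Lemma ae_haar_prod (Q : R -> Prop) : {ae @haar R, forall t, Q t} ->
  {ae hh, forall z, Q z.1 /\ Q z.2}.
Proof.
case=> N [mN N0 QN].
exists ((N `*` setT) `|` (setT `*` N)); split.
- by apply: measurableU; apply: measurableX.
- apply/eqP; rewrite eq_le measure_ge0 andbT.
  apply: (le_trans (measureU2 _ _ _)); [exact: measurableX..|].
  rewrite /= !product_measure1E//.
  by rewrite [X in (X * _ + _)%E]N0 [X in (_ + _ * X)%E]N0 mul0e mule0 adde0.
- move=> z /= /not_andP[h|h]; [left|right]; split => //; exact: QN.
Qed.

Lemma H12_ae_eq u v : measurable_fun [set: R] v -> circle_fun v ->
  {ae @haar R, forall t, u t = v t} -> H12 u -> H12 v.
Proof.
move=> mv pv uv hu; split; first split=> //.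
  case: (hu) => -[mu _ + _]; congr (_ < _)%E.
  apply: ae_eq_integral => //; try by apply/measurable_EFinP; apply: measurable_funX.
  by apply: ae_mono uv => t uv _; rewrite uv.
have mu := H12_measurable hu.
case: hu => _; congr (_ < _)%E.
under eq_integral do rewrite expr2 -/(energy_density u u _).
under [RHS]eq_integral do rewrite expr2 -/(energy_density v v _).
apply: ae_eq_integral => //; try by apply/measurable_EFinP; apply: measurable_energy_density.
by apply: ae_mono (ae_haar_prod uv) => z [e1 e2] _; rewrite /energy_density e1 e2.
Qed.

Lemma cauchy_form_ae_eq u v w : measurable_fun [set: R] u ->
  measurable_fun [set: R] v -> measurable_fun [set: R] w ->
  {ae @haar R, forall t, u t = v t} -> cauchy_form u w = cauchy_form v w.
Proof.
move=> mu mv mw uv; rewrite /cauchy_form /Rintegral; congr (_ * fine _).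
apply: ae_eq_integral => //; try by apply/measurable_EFinP; apply: measurable_energy_density.
by apply: ae_mono (ae_haar_prod uv) => z [e1 e2] _; rewrite e1 e2.
Qed.

End circle_integrands.

(** * Periodicity, reduction modulo 2pi, and chord lengths *)

Section periodic_functions.
Context {R : realType}.
Implicit Types f : R -> R.
Local Notation p2 := (pi *+ 2 : R).

Lemma pi2_gt0 : 0 < p2.
Proof. by rewrite mulrn_wgt0// pi_gt0. Qed.

Lemma circle_set_zmul (A : set R) t (k : int) : circle_set A ->
  A (t + p2 *~ k) <-> A t.
Proof.
move=> pA; have nat_ n s : A (s + p2 *+ n) <-> A s.
  by elim: n => [|n ih]; rewrite ?mulr0n ?addr0// mulrSr addrA pA.
case: k => n; first exact: nat_.
by rewrite NegzE mulrNz -(nat_ n.+1) subrK.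
Qed.

Lemma circle_fun_zmul f t (k : int) : circle_fun f -> f (t + p2 *~ k) = f t.
Proof.
move=> pf; have pA : circle_set [set s | f s = f t] by move=> s /=; rewrite pf.
exact/(circle_set_zmul t k pA).
Qed.

Lemma circle_reduce (a t : R) : exists k : int, a <= t + p2 *~ k < a + p2.
Proof.
have p0 := pi2_gt0.
exists (- Num.floor ((t - a) / p2)).
have /andP[h1 h2] := floor_itv ((t - a) / p2).
rewrite intrD mulr1z in h2.
rewrite -mulrzr mulrNz mulrN.
move: (_%:~R) h1 h2 => m; rewrite ler_pdivlMr// ltr_pdivrMr// => h1 h2.
by rewrite mulrC; apply/andP; split; lra.
Qed.

Lemma continuous_bounded_on f (a b : R) : continuous f -> a <= b ->
  exists C, forall t, a <= t <= b -> `|f t| <= C.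
Proof.
move=> cf ab; have cf' : {within `[a, b], continuous f} by exact: continuous_subspaceT.
have [c _ cM] := EVT_max ab cf'; have [d _ dm] := EVT_min ab cf'.
exists (`|f c| + `|f d|) => t tab.
have := cM t; have := dm t; rewrite in_itv/= => /(_ tab) h1 /(_ tab) h2.
have := ler_norm (f c); have := ler_norm (- f d); rewrite normrN => h3 h4.
by rewrite ler_norml; apply/andP; split; have := normr_ge0 (f c); have := normr_ge0 (f d); lra.
Qed.

Lemma circle_bounded f : continuous f -> circle_fun f ->
  exists C, forall t, `|f t| <= C.
Proof.
move=> cf pf; have [C hC] := continuous_bounded_on cf (ltW pi2_gt0).
exists C => t; have [k /andP[k1 k2]] := circle_reduce 0 t.
by rewrite -(circle_fun_zmul t k pf); apply: hC; rewrite k1 ltW//= -[X in _ < X]add0r.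
Qed.

Lemma chord_half x y : (cos x - cos y) ^+ 2 + (sin x - sin y) ^+ 2 =
  2 - 2 * cos (x - y) :> R.
Proof. rewrite cosB; have := cos2Dsin2 x; have := cos2Dsin2 y; nra. Qed.

Lemma J_chord x y : J x y = 2 / (2 - 2 * cos (x - y)) :> R.
Proof. by rewrite /J chord_half. Qed.

(* [sin x = 2 sin (x/2) cos (x/2) >= x cos^2 (x/2) = x (1 + cos x) / 2], since
   the mean value theorem gives [sin (x/2) >= (x/2) cos (x/2)]. *)
Lemma sin_ge_half (x : R) : 0 <= x <= pi / 2 -> x / 2 <= sin x.
Proof.
move=> /andP[x0 xpi]; have p1 := pihalf_ge1 R.
have [c] := @MVT_segment R sin cos 0 (x / 2) ltac:(lra)
  (fun y _ => is_derive_sin y) (continuous_subspaceT (@continuous_sin R)).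
rewrite in_itv/= sin0 !subr0 => /andP[c0 cx] e.
have ccos : cos (x / 2) <= cos c.
  move: cx; rewrite le_eqVlt => /predU1P[->//|cx].
  by apply/ltW; rewrite ltr_cos// in_itv/=; apply/andP; split; lra.
have cx0 : 0 <= cos x by apply: cos_ge0_pihalf; apply/andP; split; lra.
have -> : sin x = (cos (x / 2) * sin (x / 2)) *+ 2.
  by rewrite -sin_mulr2n; congr sin; rewrite mulr2n; field.
have ec : cos x = cos (x / 2) ^+ 2 *+ 2 - 1.
  by rewrite -cos_mulr2n; congr cos; rewrite mulr2n; field.
have ch0 : 0 <= cos (x / 2) by apply: cos_ge0_pihalf; apply/andP; split; lra.
rewrite e mulrCA; rewrite mulr2n in ec *.
have := ler_wpM2l ch0 ccos; rewrite -expr2 => h.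
have := ler_wpM2r x0 h; have := mulr_ge0 cx0 x0.
nra.
Qed.

(** Here 2 - 2 cos d = 4 sin^2(d/2), and [sin_ge_half] at |d|/2 <= pi/2 gives sin(|d|/2) >=
    |d|/4. *)
Lemma chord_lower (d : R) : `|d| <= pi -> d ^+ 2 <= 4 * (2 - 2 * cos d).
Proof.
move=> dpi; rewrite -(real_normK (num_real d)) -(cos_norm d).
have := normr_ge0 d; move: (`|d|) dpi => {}d dpi d0.
have h : d / 4 <= sin (d / 2).
  have -> : d / 4 = d / 2 / 2 by field.
  by apply: sin_ge_half; apply/andP; split; lra.
have -> : cos d = cos (d / 2) ^+ 2 *+ 2 - 1.
  by rewrite -cos_mulr2n; congr cos; rewrite mulr2n; field.
rewrite cos2sin2 mulr2n; set s := sin _ in h *.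
by nra.
Qed.

End periodic_functions.

(** * Test functions belong to H^{1/2} *)

Section test_functions.
Context {R : realType}.
Implicit Types z : testfun R.
Local Notation p2 := (pi *+ 2 : R).

Lemma testfun_derivable z (t : R) : derivable z t 1.
Proof. exact: (@tfun_smooth R z 0%N t). Qed.

Lemma testfun_continuous z : continuous z.
Proof.
by move=> t; apply/differentiable_continuous/derivable1_diffP/testfun_derivable.
Qed.

Lemma testfun_bounded z : exists C, forall t, `|z t| <= C.
Proof. exact: circle_bounded (@testfun_continuous z) (tfun_periodic z). Qed.

(** With L a bound on the derivative, the increment is at most L d for representatives at distance d
    <= pi, while [chord_lower] gives J <= 8 / d^2; the product is at most 8 L^2. *)
Lemma testfun_chord z : exists2 C, 0 <= C & forall t p : R,
  (z t - z p) ^+ 2 * J t p <= C.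
Proof.
have p0 := @pi_gt0 R.
have cz' : continuous (derive1 z).
  move=> t; apply/differentiable_continuous/derivable1_diffP.
  exact: (@tfun_smooth R z 1%N t).
(* The interval contains the representatives chosen below: the first lies in [0, 2pi[ and the second
   within pi of the first. *)
have [L hL] := @continuous_bounded_on R _ (- (pi *+ 2)) (pi *+ 3) cz' ltac:(rewrite !mulrS mulr0n; lra).
exists (8 * L ^+ 2) => [|t p]; first by rewrite mulr_ge0// sqr_ge0.
have [k kt] := circle_reduce 0 t; have [l lp] := circle_reduce (t + p2 *~ k - pi) p.
set t' := t + p2 *~ k in kt lp; set p' := p + p2 *~ l in lp.
have cJ : J t p = J t' p'.
  rewrite /J; congr (_ / (( _ - _ ) ^+ 2 + (_ - _) ^+ 2));
  by rewrite circle_fun_zmul//; move=> s; rewrite ?cosD2pi ?sinD2pi.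
have -> : z t = z t' by rewrite circle_fun_zmul//; exact: tfun_periodic.
have -> : z p = z p' by rewrite circle_fun_zmul//; exact: tfun_periodic.
rewrite {}cJ; clearbody t' p'.
have dz (s : R) : is_derive s (1 : R) (z : R -> R) (derive1 z s).
  by rewrite derive1E; apply: derivableP; exact: testfun_derivable.
have lip a b : - (pi *+ 2) <= a -> b <= pi *+ 3 -> a <= b -> `|z b - z a| <= L * `|b - a|.
  move=> a1 b1 ab; have [c] := MVT_segment ab (fun s _ => dz s)
    (continuous_subspaceT (@testfun_continuous z)).
  rewrite in_itv/= => /andP[ac cb] ->; rewrite normrM ler_wpM2r//.
  by apply: hL; rewrite (le_trans a1)//= (le_trans cb).
have {lip}lip : `|z t' - z p'| <= L * `|t' - p'|.
  rewrite !mulrS mulr0n in kt lp lip *.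
  have [tp|pt] := leP t' p'.
    by rewrite distrC (distrC t'); apply: lip => //; lra.
  by apply: lip; lra.
have d1 : `|t' - p'| <= pi by rewrite !mulrS mulr0n in lp; rewrite ler_norml; apply/andP; split; lra.
have h := chord_lower d1.
rewrite -(real_normK (num_real (z t' - z p'))).
apply: (@le_trans _ _ ((L * `|t' - p'|) ^+ 2 * J t' p')).
  rewrite ler_wpM2r ?J_ge0// lerXn2r ?nnegrE//; exact: le_trans lip.
rewrite exprMn real_normK ?num_real// -mulrA (mulrC 8) ler_wpM2l ?sqr_ge0//.
rewrite J_chord.
have := cos_le1 (t' - p'); move: (cos _) h => D h D1.
(* If the chord vanishes, the convention 0^-1 = 0 makes [J] zero. *)
have [e|e] := eqVneq (2 - 2 * D) 0; first by rewrite e invr0 !mulr0.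
by rewrite mulrA ler_pdivrMr ?lt_def ?e//=; lra.
Qed.

Lemma H12_testfun z : H12 z.
Proof.
have [B zB] := testfun_bounded z; have [C C0 zC] := testfun_chord z.
(* With zero comparison functions only the summand 1 remains, so the constant bounds both the
   function and its energy density. *)
apply: (@H12_le R z (B + C) (fun=> 0) (fun=> 0)) => //; try exact: H12_zero.
- apply: continuous_measurable_fun; exact: testfun_continuous.
- exact: tfun_periodic.
- by move=> t; rewrite (le_trans (zB t))// lerDl.
- move=> -[t p]; rewrite /energy_density/= subrr !mul0r !add0r mulr1 -expr2.
  by rewrite (le_trans (zC _ _))// lerDr (le_trans _ (zB 0)).
Qed.

End test_functions.

(** * Finite measures given by an integrable density *)

Section density_measure.
Context d (X : measurableType d) (R : realType).
Context (mu : {measure set X -> \bar R}) (g : X -> \bar R).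
Local Open Scope ereal_scope.

(** Integrability and sign of [g] are arguments, so that the finite measure structure can be
    attached to this set function. *)
Definition density_measure of mu.-integrable setT g & (forall t, 0 <= g t) :=
  fun A => \int[mu]_(t in A) g t.

Context (ig : mu.-integrable setT g) (g0 : forall t, 0 <= g t).
Local Notation nu := (density_measure ig g0).

Let nu0 : nu set0 = 0. Proof. exact: integral_set0. Qed.

Let nu_ge0 A : 0 <= nu A. Proof. exact: integral_ge0. Qed.

Let nu_sigma_additive : semi_sigma_additive nu.
Proof. by apply: semi_sigma_additive_nng_induced => //; exact: measurable_int ig. Qed.

HB.instance Definition _ := isMeasure.Build _ _ _ nu nu0 nu_ge0 nu_sigma_additive.

Let nu_fin : fin_num_fun nu.
Proof. by move=> A mA; apply: integrable_fin_num => //; exact: integrableS ig. Qed.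

HB.instance Definition _ := Measure_isFinite.Build _ _ _ nu nu_fin.

Lemma density_measure_dominated : nu `<< mu.
Proof.
apply/null_content_dominatesP => A mA A0.
by apply: null_set_integral => //; apply: measurable_funTS; exact: measurable_int ig.
Qed.

End density_measure.

(** The change of variables is known for the Radon-Nikodym derivative, which equals [g] almost
    everywhere because both have the same integral over every measurable set. *)
Lemma integral_density_measure d (X : measurableType d) (R : realType)
    (mu : {sigma_finite_measure set X -> \bar R}) (g : X -> \bar R)
    (ig : mu.-integrable setT g) (g0 : forall t, (0 <= g t)%E) (f : X -> \bar R) :
  (density_measure ig g0).-integrable setT f ->
  (\int[density_measure ig g0]_t f t = \int[mu]_t (f t * g t))%E.
Proof.
move=> fi; have dom := density_measure_dominated ig g0.
rewrite -(Radon_Nikodym_change_of_variables dom)//.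
have mf := measurable_int _ fi; have mg := measurable_int _ ig.
apply: ae_eq_integral => //.
- by apply: emeasurable_funM.
- exact: emeasurable_funM.
apply: ae_eqe_mul2l; apply: integral_ae_eq => //.
- exact: Radon_Nikodym_integrable.
- by move=> E _ mE; rewrite -Radon_Nikodym_integral.
Qed.

Lemma integrable_bounded d (X : measurableType d) (R : realType)
    (mu : {finite_measure set X -> \bar R}) (f : X -> R) (C : R) :
  measurable_fun [set: X] f -> (forall t, `|f t| <= C) ->
  mu.-integrable setT (EFin \o f).
Proof.
move=> mf fC; apply: measurable_bounded_integrable => //.
  by rewrite ltey_eq fin_num_measure.
exists C; split; first exact: num_real.
by move=> B CB t _; apply: (le_trans (fC t)); exact: ltW.
Qed.

(** Absolute continuity transfers the absence of mass outside [fund] from [mu] to [nu]. The integral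
    formula for bounded [f] serves to pair [nu] with test functions. *)
Lemma circle_density_exists (R : realType)
    (mu : {sigma_finite_measure set (measurableTypeR R) -> \bar R})
    (g : R -> \bar R) : mu (~` @fund R) = 0%E ->
  mu.-integrable setT g -> (forall t, (0 <= g t)%E) ->
  exists nu : circle_measure R, [/\ has_density nu mu g, nu `<< mu &
    forall (f : R -> R) (C : R), measurable_fun [set: R] f ->
    (forall t, `|f t| <= C) ->
    nu.-integrable setT (EFin \o f) /\
    (\int[nu]_t (f t)%:E = \int[mu]_t ((f t)%:E * g t))%E].
Proof.
move=> mu0 ig g0; have dom := density_measure_dominated ig g0.
have nu0 : density_measure ig g0 (~` @fund R) = 0%E.
  have /null_content_dominatesP := dom; apply => //.
  by apply: measurableC; exact: measurable_fund.
exists (@CircleMeasure R (density_measure ig g0) nu0); split => //.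
move=> f C mf fC.
have fi : (density_measure ig g0).-integrable setT (EFin \o f).
  exact: (@integrable_bounded _ (measurableTypeR R) _ _ f C).
by split => //; exact: (integral_density_measure fi).
Qed.

(** Continuity from above: if every [D n] had mass at least [e], so would the intersection. *)
Lemma nonincreasing_measure_lt d (X : measurableType d) (R : realType)
    (mu : {finite_measure set X -> \bar R}) (D : (set X)^nat) (e : R) :
  (forall n, measurable (D n)) -> nonincreasing_seq D ->
  (mu (\bigcap_n D n) < e%:E)%E -> exists n, (mu (D n) < e%:E)%E.
Proof.
move=> mD ndD De; apply/not_existsP => H.
have cv : mu (D n) @[n --> \oo] --> mu (\bigcap_n D n).
  apply: nonincreasing_cvg_mu => //; last exact: bigcapT_measurable.
  by rewrite ltey_eq fin_num_measure.
move: De; apply/negP; rewrite -leNgt -(cvg_lim _ cv)//.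
apply: lime_ge; first by apply/cvg_ex; eexists; exact: cv.
by near=> n; rewrite leNgt; apply/negP/H.
Unshelve. all: by end_near. Qed.

(** * Regularity of finite Borel measures on the line and on the circle *)

Section radon_regularity.
Context (R : realType).
Local Notation T := (measurableTypeR R).

(** Asking for inner and outer approximation together makes the property stable under
    complements. *)
Definition closed_open_regular (mu : {finite_measure set T -> \bar R})
    (A : set R) := forall e : R, 0 < e -> exists F U : set R,
  [/\ closed F, open U, F `<=` A, A `<=` U & (mu (U `\` F) < e%:E)%E].

(** The regular sets form a sigma-algebra containing the closed rays, which generate the Borel
    sets. *)
Lemma measurable_regular (mu : {finite_measure set T -> \bar R})
  (A : set T) : measurable A -> closed_open_regular mu A.
Proof.
rewrite [measurable](RGenCInfty.measurableE R).
apply: smallest_sub; last first.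
  move=> _ [x ->] e e0.
  (* A closed ray is its own inner approximation; the open rays from x - 1/(n+1) shrink to it from
     outside. *)
  pose D (n : nat) : set T := `](x - n.+1%:R^-1), +oo[ `\` `[x, +oo[.
  have [n Dn] : exists n, (mu (D n) < e%:E)%E.
    apply: nonincreasing_measure_lt.
    - by move=> n; apply: measurableD; exact: measurable_itv.
    - move=> m n mn; apply/subsetPset => t [/= h1 h2]; split => //.
      move: h1; rewrite in_itv/= andbT => h1; rewrite in_itv/= andbT.
      apply: le_lt_trans h1.
      by rewrite lerD2l lerN2 lef_pV2 ?posrE// ler_nat.
    - rewrite [X in mu X](_ : _ = set0) ?measure0 ?lte_fin//.
      rewrite -subset0 => t Dt; have [_ +] := Dt 0%N I; apply.
      by rewrite itvcyEbigcap => k _; have [] := Dt k I.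
  exists `[x, +oo[%classic, `](x - n.+1%:R^-1), +oo[%classic; split => //.
  - exact: rray_closed.
  - move=> t /=; rewrite in_itv/= andbT => h1; rewrite in_itv/= andbT.
    apply: lt_le_trans h1.
    by rewrite ltrBlDr ltrDl.
split.
- move=> e e0; exists set0, set0; split => //; first exact: closed0.
  by rewrite set0D measure0 lte_fin.
- move=> {}A rA e e0; have [F [U [cF oU FA AU FUe]]] := rA e e0.
  exists (~` U), (~` F); split.
  + exact: open_closedC.
  + exact: closed_openC.
  + by rewrite setTD; exact: subsetC.
  + by rewrite setTD; exact: subsetC.
  + by rewrite setDE setCK setIC -setDE.
- move=> {}A rA e e0.
  (* These errors sum to e/2, which leaves strict room below e for passing to a finite union. *)
  have e2 n : 0 < e / 2 / (2 ^ n.+1)%:R by rewrite !divr_gt0// ltr0n expn_gt0.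
  have /choice[FU hFU] : forall n, exists FU : set R * set R,
      [/\ closed FU.1, open FU.2, FU.1 `<=` A n, A n `<=` FU.2 &
        (mu (FU.2 `\` FU.1) < (e / 2 / (2 ^ n.+1)%:R)%:E)%E].
    by move=> n; have [F [U ?]] := rA n _ (e2 n); exists (F, U).
  pose F n := (FU n).1; pose U n := (FU n).2.
  have mF n : measurable (F n : set T) by apply: closed_measurable; have [] := hFU n.
  have mU n : measurable (U n : set T) by apply: open_measurable; have [] := hFU n.
  have mUU : measurable (\bigcup_n U n : set T) by exact: bigcup_measurable.
  (* A countable union of closed sets may fail to be closed, so the inner set is a partial union of
     large index. *)
  pose G (N : nat) : set T := \big[setU/set0]_(i < N) F i.
  have mG N : measurable (G N) by exact: bigsetU_measurable.
  pose D N : set T := \bigcup_n U n `\` G N.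
  have [N DN] : exists N, (mu (D N) < e%:E)%E.
    apply: nonincreasing_measure_lt.
    - by move=> n; exact: measurableD.
    - move=> m n mn; apply/subsetPset => t [h1 h2]; split => // h3; apply: h2.
      exact: subset_bigsetU h3.
    - apply: (@le_lt_trans _ _ (\sum_(0 <= n <oo) mu (U n `\` F n))%E).
        apply: measure_sigma_subadditive => [n| |].
        + exact: measurableD.
        + by apply: bigcapT_measurable => n; exact: measurableD.
        + move=> t Dt; have [[n _ Un] _] := Dt 0%N I.
          exists n => //; split => // Fn; have [_] := Dt n.+1 I; apply.
          by rewrite /G -bigcup_mkord; exists n => /=.
      apply: (@le_lt_trans _ _ (e / 2)%:E); last by rewrite lte_fin; lra.
      apply: (le_trans _ (@epsilon_trick0 R (e / 2) xpredT _)); last by lra.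
      apply: lee_nneseries => [n *|n *]; first exact: measure_ge0.
      by apply: ltW; have [] := hFU n.
  exists (G N), (\bigcup_n U n); split => //.
  + by apply: closed_bigsetU => i _; have [] := hFU i.
  + by apply: bigcup_open => n _; have [] := hFU n.
  + rewrite /G -bigcup_mkord => t [i _ Fi]; exists i => //.
    by have [_ _ h _ _] := hFU i; exact: h.
  + by move=> t [i _ Ai]; exists i => //; have [_ _ _ h _] := hFU i; exact: h.
Qed.

(** The difference, reduced to [-pi, pi[, has cosine 1, and [chord_lower] then forces it to be 0. *)
Lemma cos_sin_circle (s t : R) : cos s = cos t -> sin s = sin t ->
  exists k : int, t = s + pi *+ 2 *~ k.
Proof.
move=> ecos esin; have [k /andP[k1 k2]] := circle_reduce (- pi) (t - s).
exists (- k); set d := t - s + _ in k1 k2.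
have dpi : `|d| <= pi by rewrite ler_norml k1/= ltW// (lt_le_trans k2)// mulr2n; lra.
have := chord_lower dpi.
have -> : cos d = 1.
  rewrite /d (circle_fun_zmul _ _ (@cosD2pi R)) cosB ecos esin -!expr2.
  exact: cos2Dsin2.
rewrite mulr1 subrr mulr0 => d0.
have {d0}: d = 0 by apply/eqP; rewrite -sqrf_eq0 eq_le d0 sqr_ge0.
rewrite /d mulrNz; lra.
Qed.

Lemma circle_measure_fund (mu : circle_measure R) (A : set T) :
  measurable A -> mu A = mu (A `&` @fund R).
Proof.
move=> mA; have mf := @measurable_fund R.
rewrite (measureDI mu mA mf) [X in (X + _)%E](_ : _ = 0%E) ?add0e//.
apply/eqP; rewrite eq_le measure_ge0 andbT -(cmeasure_fund mu).
apply: le_measure; rewrite ?inE; [exact: measurableD|exact: measurableC|].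
by move=> t [].
Qed.

(* A compact subset of [[0, 2pi]] is saturated into a closed periodic set by
   pulling back its image under [(cos, sin)]. *)
Lemma circle_measure_radon (mu : circle_measure R) : radon mu.
Proof.
move=> A mA pA; apply/eqP; rewrite eq_le; apply/andP; split; last first.
  apply: ub_ereal_sup => _ [K [cK pK KA] <-]; apply: le_measure; rewrite ?inE//.
  exact: closed_measurable.
apply/lee_addgt0Pr => e e0.
have [F [U [cF oU FA AU FUe]]] := measurable_regular mu mA e0.
(* The closed interval makes [K0] compact; its extra endpoint is harmless since saturating a subset
   of the periodic set [A] stays in [A]. *)
pose I0 : set R := `[0, pi *+ 2]%classic.
pose K0 := F `&` I0.
have cK0 : compact K0.
  by rewrite /K0 setIC; apply: compact_closedI => //; exact: segment_compact.
pose c (t : R) : R * R := (cos t, sin t).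
have cc : continuous c.
  by move=> t; exact: (cvg_pair (continuous_cos (x := t)) (continuous_sin (x := t))).
have cK1 : closed (c @` K0).
  apply: compact_closed; first exact: norm_hausdorff.
  by apply: continuous_compact => //; exact: continuous_subspaceT.
pose K := c @^-1` (c @` K0).
have cK : closed K by exact: (closed_comp _ cK1).
have pK : circle_set K by move=> t; rewrite /K /= /c cosD2pi sinD2pi.
have KA : K `<=` A.
  move=> t [s [Fs _]] [e1 e2]; have [k ->] := cos_sin_circle e1 e2.
  exact/circle_set_zmul/FA.
apply: (@le_trans _ _ (mu K + e%:E)%E); last first.
  by apply: leeD2r; apply: ereal_sup_ubound; exists K.
rewrite circle_measure_fund//.
have mK : measurable (K : set T) by exact: closed_measurable.
have mUF : measurable (U `\` F : set T).
  by apply: measurableD; [exact: open_measurable|exact: closed_measurable].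
(* A point of [A] in [fund] lies in [F], hence in [K], or else in the small set [U] minus [F]. *)
apply: (@le_trans _ _ (mu K + mu (U `\` F))%E); last by rewrite leeD2l// ltW.
apply: (le_trans _ (measureU2 mu mK mUF)).
apply: le_measure; rewrite ?inE//.
- by apply: measurableI => //; exact: measurable_fund.
- exact: measurableU.
- move=> t [At It]; have [Ft|nFt] := pselect (F t); last by right; split => //; exact: AU.
  left; exists t => //; split => //; move: It; rewrite /fund /I0/= !in_itv/=.
  by move=> /andP[-> /ltW ->].
Qed.

End radon_regularity.

(** * Capacity, Haar measure and quasi-continuity *)

Section capacity.
Context (R : realType).
Local Notation T := (measurableTypeR R).
Implicit Types u v : R -> R.

Lemma cauchy_form_ge0 u : 0 <= cauchy_form u u.
Proof.
by rewrite mulr_ge0//; apply: Rintegral_ge0 => z _; exact: energy_density_ge0.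
Qed.

Lemma cap_set0_lt (e : R) : 0 < e -> (cap (@set0 R) < e%:E)%E.
Proof.
move=> e0; apply: (@le_lt_trans _ _ 0%E); last by rewrite lte_fin.
apply: (@le_trans _ _ (cap_open (@set0 R))).
  apply: ereal_inf_lbound; exists set0 => //; split => //; exact: open0.
apply: ereal_inf_lbound; exists (fun=> 0); first split.
- exact: H12_zero.
- by exists set0; split => // t /=; apply.
- rewrite /cauchy_form; under eq_Rintegral do rewrite subrr mul0r mul0r.
  under [X in _ + X]eq_Rintegral do rewrite expr0n/=.
  by rewrite /Rintegral !integral0 /= mulr0 addr0.
Qed.

Lemma continuous_quasi_continuous u : continuous u -> quasi_continuous u.
Proof.
move=> cu e e0; exists set0; split; first exact: open0.
- by [].
- exact: cap_set0_lt.
- exact: continuous_subspaceT.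
Qed.

(** Chebyshev: a competitor satisfies u >= 1 almost everywhere on [G], so the integral of u^2 alone
    already exceeds the mass of [G]. *)
Lemma haar_le_cap_open (G : set T) : measurable G -> (haar G <= cap_open G)%E.
Proof.
move=> mG; apply: le_ereal_inf_tmp => _ [u [hu u1] <-].
have [[mu _ iu] _] := hu.
have iu2 : (@haar R).-integrable setT (fun t => ((u t) ^+ 2)%:E).
  apply/integrableP; split; first by apply/measurable_EFinP; exact: measurable_funX.
  by under eq_integral do rewrite gee0_abs ?lee_fin ?sqr_ge0//.
apply: (@le_trans _ _ (\int[@haar R]_t ((u t) ^+ 2)%:E)%E); last first.
  rewrite -[leLHS]fineK ?integrable_fin_num// lee_fin.
  by rewrite lerDr cauchy_form_ge0.
rewrite -[leLHS]mul1e -integral_cst//.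
have mu2 : measurable_fun [set: T] (fun t => ((u t) ^+ 2)%:E).
  by apply/measurable_EFinP; exact: measurable_funX.
apply: (@le_trans _ _ (\int[@haar R]_(t in G) ((u t) ^+ 2)%:E)%E).
  apply: ae_ge0_le_integral => //.
  - by move=> t _; rewrite lee_fin sqr_ge0.
  - exact: measurable_funTS.
  - by apply: ae_mono u1 => t ut Gt; rewrite lee_fin; have := ut Gt; nra.
by apply: ge0_subset_integral => // t _; rewrite lee_fin sqr_ge0.
Qed.

Lemma cap0_haar0 (N : set T) : measurable N -> cap N = 0%E -> haar N = 0%E.
Proof.
move=> mN N0; apply/eqP; rewrite eq_le measure_ge0 andbT -N0.
apply: le_ereal_inf_tmp => _ [G [oG pG NG] <-].
have mG : measurable (G : set T) by exact: open_measurable.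
apply: (le_trans _ (haar_le_cap_open mG)).
by apply: le_measure; rewrite ?inE.
Qed.

(* [[set t | v t = u t]] is quasi-closed and carries [M], hence its complement
   has zero capacity, and a fortiori zero Haar measure. *)
Lemma quasi_continuous_ae_eq (M : circle_measure R) u v : structural M ->
  measurable_fun [set: R] v -> circle_fun v -> quasi_continuous v ->
  continuous u -> circle_fun u ->
  {ae M, forall t, v t = u t} -> {ae @haar R, forall t, v t = u t}.
Proof.
move=> sM mv pv qv cu pu vu.
pose F : set T := [set t | v t = u t].
have mu : measurable_fun [set: R] u by exact: continuous_measurable_fun.
have mF : measurable F.
  rewrite -[F]setTI (_ : [set: T] `&` F = [set: T] `&` [set t | (v t)%:E = (u t)%:E]).
    by apply: measurable_eqe => //; apply/measurable_EFinP.
  by apply/seteqP; split => t [_ /= h]; split => //; [rewrite /= h|case: h].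
have pF : circle_set F by move=> t; rewrite /F/= pv pu.
have MF : M (~` F) = 0%E.
  by apply/(measure_negligible _ vu); exact: measurableC.
have qF : quasi_closed F.
  move=> e e0; have [G [oG pG capG cv]] := qv e e0.
  exists G; split => //.
  have : closed ([set t | v t - u t = 0] : set (subspace (~` G))).
    have : {within ~` G, continuous (v \- u)}.
      move=> t; apply: cvgB; first exact: cv.
      exact: (continuous_subspaceT cu).
    by move/continuous_closedP => /(_ [set 0] (@closed_eq _ _)).
  (* A relatively closed subset of the complement of [G] is the trace of a closed [W]; that
     complement being closed, so is the trace. *)
  move/closed_subspaceP => [W cW WE].
  rewrite (_ : F `\` G = W `&` ~` G); first by apply: closedI => //; exact: open_closedC.
  rewrite WE; apply/seteqP; split => t [h nG]; split => //=.
    by rewrite h subrr.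
  by apply/eqP; rewrite -subr_eq0; apply/eqP.
have c0 := str_full_quasi_support sM mF pF qF MF.
exists (~` F); split => //; first exact: measurableC.
by apply: cap0_haar0 => //; exact: measurableC.
Qed.

End capacity.

(** * The carre du champ and the energy of a square *)

Section carre_du_champ.
Context (R : realType).
Local Notation T := (measurableTypeR R).
Local Notation hh := (@haar R \x @haar R)%E.
Implicit Types u : R -> R.

Lemma integral_haar_swap (f : T * T -> \bar R) :
  hh.-integrable setT f -> hh.-integrable setT (fun z => f (z.2, z.1)) ->
  (\int[hh]_z f (z.2, z.1) = \int[hh]_z f z)%E.
Proof. by move=> fi gi; rewrite -integral12_prod_meas1// -integral21_prod_meas1. Qed.

(** In this form Fubini yields both measurability and integrability of [Gamma_J u]. *)
Lemma Gamma_JE u :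
  Gamma_J u = fubini_F (@haar R) (EFin \o energy_density u u).
Proof.
by apply/funext => t; apply: eq_integral => p _; rewrite /energy_density expr2.
Qed.

Lemma Gamma_J_ge0 u t : (0 <= Gamma_J u t)%E.
Proof. by apply: integral_ge0 => p _; rewrite lee_fin mulr_ge0 ?J_ge0 ?sqr_ge0. Qed.

Lemma integrable_Gamma_J u : H12 u ->
  (@haar R).-integrable setT (Gamma_J u).
Proof. by move=> hu; rewrite Gamma_JE; exact/integrable_fubini_F/integrable_energy. Qed.

Section weighted.
Variables (u z : R -> R) (C : R).
Hypotheses (hu : H12 u) (mz : measurable_fun [set: R] z)
  (zC : forall t, `|z t| <= C).

Lemma integrable_energy_weight (w : T * T -> R) : measurable_fun setT w ->
  (forall p, `|w p| <= C) ->
  hh.-integrable setT (fun p => (w p * energy_density u u p)%:E).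
Proof.
move=> mw wC; apply: (@le_integrable _ _ _ _ _ measurableT _
  (fun p : T * T => C%:E * (energy_density u u p)%:E)%E).
- apply/measurable_EFinP; apply: measurable_funM => //.
  by apply: measurable_energy_density; exact: H12_measurable.
- move=> p _; rewrite -EFinM !abse_EFin lee_fin !normrM.
  by apply: ler_wpM2r => //; apply: (le_trans (wC p)); exact: ler_norm.
- by apply: integrableZl => //; exact: integrable_energy.
Qed.

Lemma integral_Gamma_J :
  (\int[@haar R]_t ((z t)%:E * Gamma_J u t) =
   \int[hh]_p (z p.1 * energy_density u u p)%:E)%E.
Proof.
have iu := integrable_energy hu hu.
have iw := integrable_energy_weight (measurable_comp_fst mz) (fun p => zC p.1).
rewrite -(integral12_prod_meas1 iw) Gamma_JE.
apply: ae_eq_integral => //.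
- apply: emeasurable_funM; first exact/measurable_EFinP.
  exact: measurable_fubini_F iu.
- exact: measurable_fubini_F iw.
(* The factor [z t] leaves the inner integral only where the section is integrable, which is the
   case for almost every [t]. *)
- apply: ae_mono (ae_integrable1 iu) => t ti _.
  by rewrite /fubini_F -integralZl.
Qed.

(** Boundedness of [u] and [z] makes each term of the pointwise identity integrable, so it can be
    integrated term by term. *)
Lemma cauchy_form_sqr (A : R) : H12 z -> (forall t, `|u t| <= A) ->
  cauchy_form (fun t => u t ^+ 2) z =
  2 * cauchy_form u (fun t => u t * z t) -
  fine (\int[@haar R]_t ((z t)%:E * Gamma_J u t))%E.
Proof.
move=> hz uA; have huz := H12_mul hu hz uA zC.
have iuz := integrable_energy hu huz.
have i1 := integrable_energy_weight (measurable_comp_fst mz) (fun p => zC p.1).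
have i2 := integrable_energy_weight (measurable_comp_snd mz) (fun p => zC p.2).
(* The density is symmetric in its two points, so the weights [z p.1] and [z p.2] contribute
   equally. *)
have swap : \int[hh]_p (z p.2 * energy_density u u p) =
            \int[hh]_p (z p.1 * energy_density u u p).
  rewrite /Rintegral -(integral_haar_swap i1).
    congr fine; apply: eq_integral => p _ /=; congr EFin; congr (_ * _).
    by rewrite /energy_density /= J_sym; ring.
  apply: eq_integrable i2 => // p _ /=; congr EFin; congr (_ * _).
  by rewrite /energy_density /= J_sym; ring.
rewrite integral_Gamma_J -/(Rintegral _ _ _).
have -> : 2 * cauchy_form u (fun t => u t * z t) =
    \int[hh]_p energy_density u (fun t => u t * z t) p.
  by rewrite /cauchy_form mulrA mulfV// mul1r.
(* By [swap] the two weighted integrals combine into twice one of them, which cancels the 1/2 of the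
   form. *)
rewrite /cauchy_form [X in _ * X = _](_ : _ =
    2 * \int[hh]_p energy_density u (fun t => u t * z t) p -
    (\int[hh]_p (z p.1 * energy_density u u p) +
     \int[hh]_p (z p.2 * energy_density u u p))); first by rewrite swap; field.
rewrite -RintegralD// -RintegralZl// -RintegralB//.
- by apply: eq_Rintegral => p _; rewrite /energy_density /=; ring.
- exact: (integrableZl measurableT 2 iuz).
- exact: (integrableD measurableT i1 i2).
Qed.

End weighted.
End carre_du_champ.

(** * Finite measures as distributions *)

Section distributions.
Context (R : realType).

Lemma testfun_integrable (nu : circle_measure R) (z : testfun R) :
  nu.-integrable setT (EFin \o z).
Proof.
have [C zC] := testfun_bounded z.
apply: (@integrable_bounded _ (measurableTypeR R) _ _ _ C) => //.
by apply: continuous_measurable_fun; exact: testfun_continuous.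
Qed.

Lemma is_distribution_measure (nu : circle_measure R) :
  is_distribution (measure_distr nu).
Proof.
have iz := testfun_integrable nu.
split=> [a z1 z2 z3 E|].
  rewrite /measure_distr -RintegralZl// -RintegralD//.
    by apply: eq_Rintegral => t _; rewrite E.
  exact: (integrableZl measurableT a (iz z1)).
exists (fine (nu setT)), 0%N => z B zB; rewrite mulrC.
apply: (le_trans (le_normr_Rintegral measurableT (iz z))).
rewrite -Rintegral_cst//; apply: le_Rintegral => //.
- exact: (integrable_abse (iz z)).
- by apply/finite_measure_integrable_cst.
- by move=> t _; exact: (zB 0%N).
Qed.

Lemma is_distributionB (x y : testfun R -> R) : is_distribution x ->
  is_distribution y -> is_distribution (x \- y).
Proof.
move=> [lx [C [k bx]]] [ly [D [l by_]]]; split=> [a z1 z2 z3 E|].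
  by rewrite /= (lx _ _ _ _ E) (ly _ _ _ _ E); ring.
exists (C + D), (maxn k l) => z B zB; rewrite mulrDl.
apply: (le_trans (ler_normB _ _)); apply: lerD.
  by apply: bx => j t jk; apply: zB; rewrite (leq_trans jk)// leq_maxl.
by apply: by_ => j t jl; apply: zB; rewrite (leq_trans jl)// leq_maxr.
Qed.

End distributions.

(** * Continuous eigenfunctions and their squares *)

Section eigenfunctions.
Context (R : realType) (M : circle_measure R).
Implicit Types u w : R -> R.

Lemma haar_fundC : haar (~` @fund R) = 0%E.
Proof. by rewrite /haar /mscale /= /mrestr setICl measure0 mule0. Qed.

Lemma L2_bounded u (C : R) : measurable_fun [set: R] u -> circle_fun u ->
  (forall t, `|u t| <= C) -> L2 M u.
Proof.
move=> mu pu uC; split => //.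
have : M.-integrable setT (EFin \o (fun t => u t ^+ 2)).
  apply: (@integrable_bounded _ (measurableTypeR R) _ _ _ (C ^+ 2)).
    exact: measurable_funX.
  move=> t; rewrite normrX lerXn2r ?nnegrE//; exact: le_trans (uC t).
move=> /integrableP[_]; congr (_ < _)%E; apply: eq_integral => t _ /=.
by rewrite ger0_norm// sqr_ge0.
Qed.

Lemma quasi_version_refl u : H12 u -> continuous u -> quasi_version u u.
Proof.
move=> hu cu; split => //; first exact: continuous_quasi_continuous.
by exists set0; split => // t /=; apply.
Qed.

Variables (Lambda : R) (phi : R -> R).
Hypotheses (sM : structural M) (cphi : continuous phi) (pphi : circle_fun phi)
  (ephi : operator_graph M phi (fun t => Lambda * phi t)).

(** Restricting to continuous [w] lets [w] be its own quasi-continuous version, and [w] is then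
    bounded, hence in L^2(M). *)
Lemma eigenfunction_form : H12 phi /\
  forall w, H12 w -> continuous w ->
    cauchy_form phi w = Lambda * \int[M]_t (phi t * w t).
Proof.
case: ephi => _ _ [u [v [hu [hv qv vu] vphi weak]]].
have mphi : measurable_fun [set: R] phi by exact: continuous_measurable_fun.
have [[mv pv _] _] := hv.
have vphi' := quasi_continuous_ae_eq sM mv pv qv cphi pphi vphi.
have hphi : H12 phi := H12_ae_eq mphi pphi vphi' hv.
split => // w hw cw.
have mw := H12_measurable hw; have [[_ pw _] _] := hw.
have [A phiA] := circle_bounded cphi pphi; have [B wB] := circle_bounded cw pw.
have Lw := L2_bounded mw pw wB.
(* The form sees only Haar classes: [phi] is replaced by the quasi-continuous [v], then [v] by the
   [u] of the weak equation. *)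
rewrite -(cauchy_form_ae_eq mv mphi mw vphi').
rewrite (cauchy_form_ae_eq mv (H12_measurable hu) mw vu).
rewrite (weak w w hw (quasi_version_refl hw cw) Lw) -RintegralZl//.
  by apply: eq_Rintegral => t _; rewrite mulrA.
apply: (@integrable_bounded _ (measurableTypeR R) _ _ _ (A * B)).
  exact: measurable_funM.
by move=> t; rewrite normrM ler_pM.
Qed.

Lemma eigenfunction_cauchy_form_sqr (z : testfun R) :
  cauchy_form (fun t => phi t ^+ 2) z =
  2 * Lambda * \int[M]_t (z t * phi t ^+ 2)
  - fine (\int[@haar R]_t ((z t)%:E * Gamma_J phi t))%E.
Proof.
have [hphi weak] := eigenfunction_form.
have [A phiA] := circle_bounded cphi pphi; have [B zB] := testfun_bounded z.
have hz := H12_testfun z; have cz := @testfun_continuous R z.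
rewrite (cauchy_form_sqr hphi (H12_measurable hz) zB hz phiA) weak.
- rewrite mulrA; congr (_ * _ - _); apply: eq_Rintegral => t _.
  by rewrite expr2; ring.
- exact: H12_mul phiA zB.
- by move=> t; apply: continuousM; [exact: cphi|exact: cz].
Qed.

(** The square is continuous and bounded, so it represents itself and lies in L^2 of the finite
    measure [M]. *)
Lemma eigenfunction_sqr_V : V M (fun t => phi t ^+ 2).
Proof.
have [hphi _] := eigenfunction_form.
have [A phiA] := circle_bounded cphi pphi.
have h2 : H12 (fun t => phi t ^+ 2) by exact: (H12_mul hphi hphi phiA phiA).
have c2 : continuous (fun t => phi t ^+ 2).
  by move=> t; apply: continuousM; exact: cphi.
have [[m2 p2 _] _] := h2; have [B sB] := circle_bounded c2 p2.
split => //; exists (fun t => phi t ^+ 2); split; first exact: quasi_version_refl.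
exact: L2_bounded sB.
Qed.

(** The first density is nonnegative because [Lambda] is positive, and bounded; the second is
    integrable because [phi] has finite energy. *)
Lemma eigenfunction_measures : 0 < Lambda -> exists nu1 nu2 : circle_measure R,
  [/\ has_density nu1 M (fun t => (2 * Lambda * phi t ^+ 2)%:E),
      has_density nu2 (@haar R) (Gamma_J phi),
      radon nu1 /\ radon nu2,
      nu2 `<< @haar R &
      is_distribution (A0 (fun t => phi t ^+ 2)) /\
      A0 (fun t => phi t ^+ 2) = measure_distr nu1 \- measure_distr nu2].
Proof.
move=> L0; have [hphi _] := eigenfunction_form.
have mphi := H12_measurable hphi.
have [A phiA] := circle_bounded cphi pphi.
have mg : measurable_fun [set: R] (fun t => 2 * Lambda * phi t ^+ 2).
  by apply: measurable_funM => //; exact: measurable_funX.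
have gA t : `|2 * Lambda * phi t ^+ 2| <= 2 * Lambda * A ^+ 2.
  have L2 : 0 <= 2 * Lambda by rewrite mulr_ge0// ltW.
  rewrite normrM ger0_norm// ler_wpM2l// normrX lerXn2r ?nnegrE//.
  exact: le_trans (phiA t).
have g0 t : (0 <= (2 * Lambda * phi t ^+ 2)%:E)%E.
  by rewrite lee_fin mulr_ge0 ?sqr_ge0// mulr_ge0// ltW.
have [nu1 [d1 _ int1]] := @circle_density_exists R M _ (cmeasure_fund M)
  (@integrable_bounded _ (measurableTypeR R) _ _ _ _ mg gA)
  g0.
have [nu2 [d2 dom int2]] := @circle_density_exists R (@haar R) _ haar_fundC
  (integrable_Gamma_J hphi) (Gamma_J_ge0 phi).
have AE : A0 (fun t => phi t ^+ 2) = measure_distr nu1 \- measure_distr nu2.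
  apply/funext => z /=; have [B zB] := testfun_bounded z.
  have mz := H12_measurable (H12_testfun z).
  rewrite /A0 eigenfunction_cauchy_form_sqr /measure_distr /Rintegral.
  have [_ ->] := int1 z B mz zB; have [_ ->] := int2 z B mz zB.
  congr (_ - _).
  rewrite -/(Rintegral M setT (fun t => z t * phi t ^+ 2)) -RintegralZl//.
    rewrite /Rintegral; congr fine; apply: eq_integral => t _.
    by rewrite -EFinM; congr EFin; ring.
  apply: (@integrable_bounded _ (measurableTypeR R) _ _ _ (B * A ^+ 2)).
    by apply: measurable_funM => //; exact: measurable_funX.
  move=> t; rewrite normrM ler_pM// normrX lerXn2r ?nnegrE//.
  exact: le_trans (phiA t).
exists nu1, nu2; split => //; first by split; exact: circle_measure_radon.
(* Linearity and the seminorm bound for [A0] are read off from the difference of two measures. *)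
split => //; rewrite AE.
by apply: is_distributionB; exact: is_distribution_measure.
Qed.

End eigenfunctions.

Theorem lemma7p10 (R : realType) (gamma s : R) (P : probability (XCb s) R)
    (dw : circle_measure R -> circle_measure R -> R) (eps : nat -> R)
    (Ostr : set (XCb s)) (x : XC s) (Lambda : R) (phi : R -> R)
    (kappa := gamma / 2) (M := gmc kappa P dw eps x)
    (hgamma : 0 < gamma < 2) (hs : 0 < s)
    (hP : is_field_law P) (hdw : narrow_metric dw)
    (heps : admissible_scales kappa P dw eps)
    (hOstr : is_Omega_str kappa P dw eps Ostr) (hx : Ostr x)
    (hphi_cont : continuous phi) (hphi_circle : circle_fun phi)
    (hphi_eigen : operator_graph M phi (fun t => Lambda * phi t))
    (hphi_norm : \int[M]_t (phi t) ^+ 2 = 1)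
    (hLambda : 0 < Lambda) :
  [/\ V M (fun t => phi t ^+ 2),
      exists nu1 nu2 : circle_measure R,
        [/\ has_density nu1 M (fun t => (2 * Lambda * phi t ^+ 2)%:E),
            has_density nu2 (@haar R) (Gamma_J phi),
            radon nu1 /\ radon nu2,
            nu2 `<< @haar R &
            is_distribution (A0 (fun t => phi t ^+ 2)) /\
            A0 (fun t => phi t ^+ 2) = measure_distr nu1 \- measure_distr nu2] &
      forall zeta : testfun R,
        cauchy_form (fun t => phi t ^+ 2) zeta =
        2 * Lambda * \int[M]_t (zeta t * phi t ^+ 2)
        - fine (\int[@haar R]_t ((zeta t)%:E * Gamma_J phi t))%E].
Proof.
have sM : structural M := Ostr_structural hOstr hx.
split.
- exact: eigenfunction_sqr_V sM hphi_cont hphi_circle hphi_eigen.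
- exact: eigenfunction_measures sM hphi_cont hphi_circle hphi_eigen hLambda.
- exact: eigenfunction_cauchy_form_sqr sM hphi_cont hphi_circle hphi_eigen.
Qed.
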